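(* Let $(X,\|\cdot\|)$ be an AM-space with unit, denoted by $e$, and let $\omega$ be the seminorm $\omega(x)=\inf\{b-a\mid a,b\in\mathbb R,\ ae\le x\le be\}$ on $X$. Let $F:X\to X$ be additively homogeneous ($F(x+te)=F(x)+te$ for all $x\in X$, $t\in\mathbb R$) and order preserving ($x\le y$ implies $F(x)\le F(y)$). Let $S=\{x\in X\mid F(x)=x\}$, and assume that $v\in S$. Assume: (A1) $F$ is semidifferentiable at $v$, with semidifferential $F'_v:X\to X$; (A2) $\tilde r(F'_v)<1$, where $\tilde r$ is the spectral radius defined with respect to the seminorm $\omega$. Then, for all $x\in X$, $$\limsup_{k\to\infty}\omega(F^k(x)-v)^{1/k}\le\tilde r(F'_v),$$ and there is a scalar $\lambda\in\mathbb R$ (depending on $x$) such that $$\limsup_{k\to\infty}\|F^k(x)-\lambda e-v\|^{1/k}\le\tilde r(F'_v).$$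
   Context: AM-space with unit: a (real) Banach lattice $(X,\|\cdot\|,\le)$ equipped with a distinguished element $e\ge0$ (the unit) such that $\|x\|=\inf\{a\ge0\mid -ae\le x\le ae\}$ for all $x\in X$ (equivalently, up to isometric lattice isomorphism, $X=\mathscr C(K)$ with the sup-norm for a compact Hausdorff space $K$, with $e$ the constant function $1$). Spectral radius with respect to the seminorm $\omega$: for a positively homogeneous self-map $h$ of $X$, $\omega(h)=\sup\{\omega(h(x))/\omega(x)\mid x\in X,\ \omega(x)\ne0\}\in[0,+\infty]$ and $\tilde r(h)=\lim_{k\to\infty}\omega(h^k)^{1/k}$, where $h^k$ denotes the $k$-th iterate. Semidifferentiability: let $G\subset X$ and $v$ an interior point of $G$. A map $F:G\to X$ is semidifferentiable at $v$ if there exists a continuous, positively homogeneous map $h:X\to X$ (i.e. $h(tx)=th(x)$ for all $t>0$, $x\in X$) such that $F(v+x)=F(v)+h(x)+o(\|x\|)$ as $x\to0$. Such $h$ is unique and denoted $F'_v$ (the semidifferential of $F$ at $v$). *)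

(* Defs.v *)
From HB Require Import structures.
From mathcomp Require Import all_boot all_order all_algebra.
From mathcomp Require Import all_classical all_reals all_analysis.
Set Implicit Arguments.
Unset Strict Implicit.
Unset Printing Implicit Defensive.
Import Order.TTheory GRing.Theory Num.Theory numFieldNormedType.Exports.
Local Open Scope classical_set_scope.
Local Open Scope ring_scope.

(* The order is carried by a mixin rather than inherited from the library's
   lattice structures: Hierarchy-Builder cannot join those with a normed module
   after numDomainType has been declared. *)
HB.mixin Record CompleteNormedModule_isBanachLattice (R : realType) (X : Type)
    of CompleteNormedModule R X := {
  bl_le : rel X ;
  bl_join : X -> X -> X ;
  bl_meet : X -> X -> X ;
  bl_le_refl : reflexive bl_le ;
  bl_le_anti : antisymmetric bl_le ;
  bl_le_trans : transitive bl_le ;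
  bl_leUx : forall x y z : X,
    bl_le (bl_join x y) z = bl_le x z && bl_le y z ;
  bl_lexI : forall x y z : X,
    bl_le x (bl_meet y z) = bl_le x y && bl_le x z ;
  bl_leD2r : forall x y z : X, bl_le x y -> bl_le (x + z) (y + z) ;
  bl_leZ2l : forall (a : R) (x y : X),
    0 <= a -> bl_le x y -> bl_le (a *: x) (a *: y) ;
  (* The absolute value of x is the join of x and - x. *)
  bl_le_norm : forall x y : X,
    bl_le (bl_join x (- x)) (bl_join y (- y)) -> `|x| <= `|y|
}.

#[short(type="banachLatticeType")]
HB.structure Definition BanachLattice (R : realType) :=
  {X of CompleteNormedModule R X & CompleteNormedModule_isBanachLattice R X}.

Section AMSpace.
Context (R : realType) (X : banachLatticeType R).

Local Notation "x <=l y" := (bl_le x y) (at level 70, no associativity).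

(* The infimum is taken in the extended reals, so that it is +oo, and cannot
   be a norm, when x is not bounded by a multiple of e. *)
Definition is_am_unit (e : X) : Prop :=
  0 <=l e /\
  forall x : X, (`|x|)%:E =
    ereal_inf [set a%:E | a in [set a : R |
      [/\ 0 <= a, - (a *: e) <=l x & x <=l a *: e]]].

(* For a unit e != 0 the set below is nonempty and bounded below by 0. If
   X = {0} it is all of R, of which inf is 0, so that omega e is the zero
   seminorm. *)
Definition omega (e x : X) : R :=
  inf [set c : R | exists a b : R,
    [/\ c = b - a, a *: e <=l x & x <=l b *: e]].

Definition additively_homogeneous (e : X) (F : X -> X) : Prop :=
  forall (x : X) (t : R), F (x + t *: e) = F x + t *: e.

Definition order_preserving (F : X -> X) : Prop :=
  forall x y : X, x <=l y -> F x <=l F y.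

Definition positively_homogeneous (h : X -> X) : Prop :=
  forall (t : R) (x : X), 0 < t -> h (t *: x) = t *: h x.

(* The supremum is taken in [0, +oo]: it is 0 when omega e vanishes
   identically, i.e. when X has dimension at most 1. *)
Definition omega_op (e : X) (h : X -> X) : \bar R :=
  maxe 0%E (ereal_sup
    [set (omega e (h x) / omega e x)%:E | x in [set x | omega e x != 0]]).

(* limn is a junk value on divergent sequences; for h positively homogeneous,
   order preserving and additively homogeneous (as semidifferentials of such
   maps are), the limit exists by submultiplicativity. *)
Definition omega_spectral_radius (e : X) (h : X -> X) : \bar R :=
  limn (fun k : nat => (omega_op e (iter k h) `^ (k%:R)^-1)%E).

Definition is_semidifferential (F : X -> X) (v : X) (h : X -> X) : Prop :=
  [/\ continuous h, positively_homogeneous h &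
    (fun x => F (v + x)) = (fun x => F v + h x) +o_ (0 : X) (fun x => `|x|)].

Definition semidifferentiable (F : X -> X) (v : X) : Prop :=
  exists h : X -> X, is_semidifferential F v h.

(* A semidifferential is unique when it exists, so the choice is immaterial. *)
Definition semidifferential (F : X -> X) (v : X) : X -> X :=
  xget (fun _ : X => 0 : X) [set h | is_semidifferential F v h].

End AMSpace.

(* Main.v *)
Require Import Defs.
From mathcomp Require Import all_boot all_order all_algebra.
From mathcomp Require Import all_classical all_reals all_analysis.
From mathcomp Require Import ring lra.
Import Order.TTheory GRing.Theory Num.Theory numFieldNormedType.Exports.
Local Open Scope classical_set_scope.
Local Open Scope ring_scope.

(* Put G y = F (v + y) - v, which fixes 0 and is nonexpansive for the norm and
   for omega. If L is the spectral radius of h and L < s < 1, then some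
   iterate h^m contracts omega by a factor less than s^m; by the chain rule,
   G^m contracts omega by s^m on a small omega-ball around 0, points being moved
   along the line R e to make their norm comparable to their omega-seminorm.
   Nonexpansiveness along rays brings every orbit into that ball, hence
   omega (G^k y) = O(s^k). Finally omega (G^k y) bounds the distance from G^k y
   to lambda e, where lambda is the supremum of all a such that a e <= G^k y for
   some k. *)

(** * Geometric bounds and n-th roots of real sequences *)

(** Strong induction in steps of [m]: an index from [N + m] on goes back to one still at least [N],
    and the first [N + m] values are absorbed into the constant, a sum of nonnegative ratios. *)
Lemma recurrence_geometric_bound (R : realFieldType) (a : nat -> R) (s : R)
    (m N : nat) : 0 < s -> (0 < m)%N -> (forall n, 0 <= a n) ->
  (forall n, (N <= n)%N -> a (m + n)%N <= s ^+ m * a n) ->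
  exists C, forall n, a n <= C * s ^+ n.
Proof.
move=> s0 m0 a0 am; exists (\sum_(i < N + m) a i / s ^+ i); set C := \sum_(i < _) _.
have C0 i : 0 <= a i / s ^+ i by rewrite divr_ge0 ?exprn_ge0 ?(ltW s0).
elim/ltn_ind => n IH; have [nNm|Nmn] := ltnP n (N + m).
  rewrite -ler_pdivrMr ?exprn_gt0// /C (bigD1 (Ordinal nNm))//= lerDl.
  by apply: sumr_ge0.
have mn : (m <= n)%N := leq_trans (leq_addl N m) Nmn.
have Nn : (N <= n - m)%N by rewrite leq_subRL// addnC.
rewrite -(subnKC mn) (le_trans (am _ Nn))// exprD mulrCA ler_wpM2l ?exprn_ge0 ?(ltW s0)//.
by apply: IH; rewrite ltn_subrL m0 (leq_trans m0 mn).
Qed.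

(** The constant disappears because [(s / t) ^+ n] tends to 0 and so is eventually at most
    [(C + 1)^-1]; adding 1 keeps the divisor positive when [C = 0]. *)
Lemma geometric_root_le {R : realType} (a : nat -> R) (s t C : R) :
  0 < s -> s < t -> (forall n, 0 <= a n) -> (forall n, a n <= C * s ^+ n) ->
  \forall n \near \oo, a n `^ (n%:R)^-1 <= t.
Proof.
move=> s0 st a0 aC; have t0 : 0 < t := lt_trans s0 st.
have C0 : 0 <= C by have := le_trans (a0 0%N) (aC 0%N); rewrite expr0 mulr1.
have st1 : `|s / t| < 1.
  by rewrite ger0_norm ?divr_ge0 ?(ltW s0) ?(ltW t0)// ltr_pdivrMr// mul1r.
have C1 : 0 < C + 1 by rewrite ltr_wpDl.
have := cvg_expr st1 => /cvgrPdist_le/(_ (C + 1)^-1); rewrite invr_gt0 => /(_ C1).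
move=> H; near=> n.
have n0 : (0 < n)%N by near: n; exists 1%N.
have : `|0 - (s / t) ^+ n| <= (C + 1)^-1 by near: n; exact: H.
rewrite sub0r normrN ger0_norm ?exprn_ge0 ?divr_ge0 ?(ltW s0) ?(ltW t0)//.
rewrite -[(C + 1)^-1]mul1r ler_pdivlMr// expr_div_n mulrAC ler_pdivrMr ?exprn_gt0// mul1r => h.
have {h} h : a n <= t ^+ n.
  apply: le_trans h; apply: le_trans (aC n) _.
  by rewrite mulrC ler_wpM2l ?exprn_ge0 ?(ltW s0)// lerDl.
have rn : 0 <= n%:R^-1 :> R by rewrite invr_ge0.
have := @ge0_ler_powR R _ rn (a n) (t ^+ n).
rewrite !nnegrE => /(_ (a0 n) (exprn_ge0 _ (ltW t0)) h).
by rewrite -powR_mulrn ?(ltW t0)// -powRrM divff ?pnatr_eq0 -?lt0n// powRr1 ?(ltW t0).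
Unshelve. all: by end_near. Qed.

Lemma limn_esup_root_le {R : realType} (a : nat -> R) (L : R) :
  0 <= L -> (forall n, 0 <= a n) ->
  (forall s, L < s -> exists C, forall n, a n <= C * s ^+ n) ->
  (limn_esup (fun n => (a n `^ (n%:R)^-1)%:E) <= L%:E)%E.
Proof.
move=> L0 a0 aL; apply/lee_addgt0Pr => eps eps0.
have [C aC] := aL (L + eps / 2) (ltac:(by rewrite ltrDl divr_gt0)).
have := @geometric_root_le R a (L + eps / 2) (L + eps) C.
move=> /(_ (ltac:(lra)) (ltac:(lra)) a0 aC) near_le.
rewrite /limn_esup limf_esupE; apply: ge_ereal_inf.
pose V := [set n | a n `^ n%:R^-1 <= L + eps].
exists (ereal_sup [set (a n `^ n%:R^-1)%:E | n in V]); first by exists V.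
by apply: ge_ereal_sup => _ [n /= an <-]; rewrite lee_fin.
Qed.

(* Fekete's subadditive lemma in multiplicative form. *)
Lemma submultiplicative_root_cvg {R : realType} (u : nat -> R) :
  (forall n, 0 <= u n) -> (forall m n, u (m + n)%N <= u m * u n) ->
  exists L : R, [/\ 0 <= L,
    limn (fun n => (u n `^ (n%:R)^-1)%:E) = L%:E &
    forall s, L < s -> exists2 m, (0 < m)%N & u m < s ^+ m].
Proof.
(* Index 0 is excluded: the exponent there is the inverse of 0, which is 0, and the power is 1
   whatever [u 0] is. *)
move=> u0 uM; pose E := [set u n `^ (n%:R)^-1 | n in [set n | (0 < n)%N]].
have E0 : E !=set0 by exists (u 1%N `^ (1%:R)^-1), 1%N.
have lbE : lbound E 0 by move=> _ [n _ <-]; exact: powR_ge0.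
have hlE : has_lbound E by exists 0.
have L0 : 0 <= inf E by exact: lb_le_inf.
have small s : inf E < s -> exists2 m, (0 < m)%N & u m < s ^+ m.
  move=> Es; have [_ [m m0 <-]] := inf_adherent (eps := s - inf E)
    (ltac:(by rewrite subr_gt0)) (conj E0 hlE).
  rewrite addrC subrK => us; exists m => //.
  have s0 : 0 < s := le_lt_trans L0 Es.
  have rm : 0 < m%:R :> R by rewrite ltr0n.
  have := @gt0_ltr_powR R _ rm (u m `^ m%:R^-1) s.
  rewrite !nnegrE powR_ge0 => /(_ isT (ltW s0) us).
  by rewrite -powRrM mulVf ?pnatr_eq0 -?lt0n// powRr1// powR_mulrn ?(ltW s0).
exists (inf E); split=> //.
suff cv : (u n `^ n%:R^-1) @[n --> \oo] --> inf E.
  by apply: cvg_lim => //; apply: cvg_EFin => //; exact: nearW.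
apply/cvgrPdist_le => eps eps0.
(* Submultiplicativity turns this single [m] into a recurrence valid from index 0 on, which replaces
   Euclidean division by [m]. *)
have [m m0 um] := small (inf E + eps / 2) (ltac:(by rewrite ltrDl divr_gt0)).
have s0 : 0 < inf E + eps / 2 by lra.
have [n _|C uC] := @recurrence_geometric_bound R u _ m 0 s0 m0 u0.
  by rewrite (le_trans (uM m n))// ler_wpM2r// ltW.
have near_le := @geometric_root_le R u _ (inf E + eps) C s0 (ltac:(lra)) u0 uC.
near=> n.
have n0 : (0 < n)%N by near: n; exists 1%N.
have h1 : u n `^ n%:R^-1 <= inf E + eps by near: n; exact: near_le.
have h2 : inf E <= u n `^ n%:R^-1 by apply: ge_inf => //; exists n.
by rewrite distrC ger0_norm ?subr_ge0// lerBlDl.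
Unshelve. all: by end_near. Qed.

(** * Order arithmetic in a Banach lattice *)

Section BanachLatticeOrder.
Context (R : realType) (X : banachLatticeType R).
Implicit Types (x y z : X) (a b : R).

Lemma bl_leD x y z t : bl_le x y -> bl_le z t -> bl_le (x + z) (y + t).
Proof.
move=> xy zt; apply: (bl_le_trans (y + z)); first exact: bl_leD2r.
by rewrite ![y + _]addrC; exact: bl_leD2r.
Qed.

Lemma bl_leN x y : bl_le x y -> bl_le (- y) (- x).
Proof.
move=> /(@bl_leD2r _ _ _ _ (- x - y)).
by rewrite addrA subrr add0r [- x - y]addrC addrA subrr add0r.
Qed.

Lemma bl_leBlDr x y z : bl_le (x - y) z = bl_le x (z + y).
Proof.
by apply/idP/idP => [/(@bl_leD2r _ _ _ _ y)|/(@bl_leD2r _ _ _ _ (- y))];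
  rewrite ?subrK// addrK.
Qed.

Lemma bl_leBrDr x y z : bl_le x (y - z) = bl_le (x + z) y.
Proof.
by apply/idP/idP => [/(@bl_leD2r _ _ _ _ z)|/(@bl_leD2r _ _ _ _ (- z))];
  rewrite ?subrK// addrK.
Qed.

Lemma bl_leZ2r (e : X) a b : bl_le 0 e -> a <= b -> bl_le (a *: e) (b *: e).
Proof.
move=> e0 ab; rewrite -[X in bl_le X]add0r -bl_leBrDr -scalerBl -(scaler0 X (b - a)).
by apply: bl_leZ2l; rewrite ?subr_ge0.
Qed.

End BanachLatticeOrder.

(** * Norm and seminorm in an AM-space with unit *)

Section AMUnit.
Context (R : realType) (X : banachLatticeType R) (e : X) (he : is_am_unit e).
Implicit Types (x y : X) (a b c t : R).
Let e0 : bl_le 0 e. Proof. by case: he. Qed.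

Lemma am_norm_lt x c : `|x| < c -> bl_le (- (c *: e)) x && bl_le x (c *: e).
Proof.
move=> xc; have : (`|x|%:E < c%:E)%E by rewrite lte_fin.
rewrite (he.2 x) => /ereal_inf_lt [_ [a [a0 ax xa] <-]]; rewrite lte_fin => /ltW ac.
apply/andP; split; last by apply: bl_le_trans xa _; exact: bl_leZ2r.
by apply: bl_le_trans ax; apply: bl_leN; exact: bl_leZ2r.
Qed.

Lemma am_norm_le x c : 0 <= c -> bl_le (- (c *: e)) x -> bl_le x (c *: e) ->
  `|x| <= c.
Proof.
by move=> c0 cx xc; rewrite -lee_fin (he.2 x); apply: ereal_inf_lbound; exists c.
Qed.

Lemma am_unit0 x : e = 0 -> x = 0.
Proof.
move=> ee; apply/eqP; rewrite -normr_le0; apply: am_norm_le => //.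
  by have /andP[] := am_norm_lt x (`|x| + 1) (ltac:(by rewrite ltrDl)); rewrite ee !scaler0.
by have /andP[] := am_norm_lt x (`|x| + 1) (ltac:(by rewrite ltrDl)); rewrite ee !scaler0.
Qed.

(** If [b < a], then [(a - b) *: e] is below 0; rescaling gives e below 0, hence [e = 0] by
    antisymmetry. *)
Lemma am_unit_le a b x : e != 0 -> bl_le (a *: e) x -> bl_le x (b *: e) -> a <= b.
Proof.
move=> en0 ax xb; rewrite leNgt; apply/negP => ba; move/eqP: en0; apply.
have : bl_le ((a - b) *: e) 0.
  by rewrite scalerBl bl_leBlDr add0r; exact: bl_le_trans ax xb.
move=> /(@bl_leZ2l _ _ (a - b)^-1) => /(_ (ltac:(by rewrite invr_ge0 subr_ge0 ltW))).
rewrite scalerA mulVf ?subr_eq0 ?gt_eqF// scale1r scaler0 => ele0.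
by apply: bl_le_anti; rewrite ele0 e0.
Qed.

Let omega_set x := [set c : R | exists a b : R,
    [/\ c = b - a, bl_le (a *: e) x & bl_le x (b *: e)]].

Lemma omega_trivial x : e = 0 -> omega e x = 0.
Proof.
(* Every real lies in the set, so it has no lower bound and [inf] takes its default value 0. *)
move=> ee; apply: inf_out => -[_ [l lP]].
have /lP : omega_set x (l - 1).
  by exists 0, (l - 1); rewrite subr0 (am_unit0 x ee) ee !scaler0 bl_le_refl.
by rewrite leNgt gtrBl ltr01.
Qed.

Lemma omega_le a b x : a <= b -> bl_le (a *: e) x -> bl_le x (b *: e) ->
  omega e x <= b - a.
Proof.
move=> ab ax xb; have [ee|en0] := eqVneq e 0.
  by rewrite omega_trivial// subr_ge0.
apply: ge_inf; last by exists a, b.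
by exists 0 => _ [c [d [-> cx xd]]]; rewrite subr_ge0; exact: am_unit_le cx xd.
Qed.

Lemma omega_ge0 x : 0 <= omega e x.
Proof.
have [ee|en0] := eqVneq e 0; first by rewrite omega_trivial.
apply: lb_le_inf; last first.
  by move=> _ [c [d [-> cx xd]]]; rewrite subr_ge0; exact: am_unit_le cx xd.
have /andP[? ?] := am_norm_lt x (`|x| + 1) (ltac:(by rewrite ltrDl)).
by exists ((`|x| + 1) - (- (`|x| + 1))), (- (`|x| + 1)), (`|x| + 1); rewrite scaleNr.
Qed.

Lemma omega_lt x c : omega e x < c -> exists a b,
  [/\ a <= b, b - a < c, bl_le (a *: e) x & bl_le x (b *: e)].
Proof.
have [ee|en0] := eqVneq e 0 => xc.
  exists 0, 0; rewrite (am_unit0 x ee) scale0r bl_le_refl subrr.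
  by rewrite (le_lt_trans (omega_ge0 x) xc).
have hi : has_inf (omega_set x).
  split; last first.
    by exists 0 => _ [a [b [-> ax xb]]]; rewrite subr_ge0; exact: am_unit_le ax xb.
  have /andP[? ?] := am_norm_lt x (`|x| + 1) (ltac:(by rewrite ltrDl)).
  by exists ((`|x| + 1) - (- (`|x| + 1))), (- (`|x| + 1)), (`|x| + 1); rewrite scaleNr.
have [_ [a [b [-> ax xb]]]] := inf_adherent (eps := c - omega e x)
  (ltac:(by rewrite subr_gt0)) hi.
rewrite -[inf _]/(omega e x) addrCA subrr addr0 => bac.
by exists a, b; split => //; exact: am_unit_le ax xb.
Qed.

Lemma omegaD x y : omega e (x + y) <= omega e x + omega e y.
Proof.
apply/ler_addgt0Pr => eps eps0.
have [a [b [ab bax ax xb]]] := omega_lt x (omega e x + eps / 2) (ltac:(by rewrite ltrDl divr_gt0)).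
have [c [d [cd dcy cy yd]]] := omega_lt y (omega e y + eps / 2) (ltac:(by rewrite ltrDl divr_gt0)).
have := @omega_le (a + c) (b + d) (x + y) (lerD ab cd).
rewrite !scalerDl => /(_ (bl_leD _ _ _ _ _ _ ax cy) (bl_leD _ _ _ _ _ _ xb yd)).
by lra.
Qed.

Lemma omega_le_norm x : omega e x <= 2 * `|x|.
Proof.
apply/ler_addgt0Pr => eps eps0.
have xe : `|x| < `|x| + eps / 2 by rewrite ltrDl divr_gt0.
have /andP[ax xb] := am_norm_lt x _ xe.
have := @omega_le (- (`|x| + eps / 2)) (`|x| + eps / 2) x.
rewrite scaleNr => /(_ _ ax xb); have := normr_ge0 x; lra.
Qed.

(** One inequality holds for every positive scalar; applying it to [t^-1] and [t *: x] gives the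
    other. *)
Lemma omegaZ t x : 0 < t -> omega e (t *: x) = t * omega e x.
Proof.
have leZ s y : 0 < s -> omega e (s *: y) <= s * omega e y.
  move=> s0; rewrite -ler_pdivrMl//; apply/ler_addgt0Pr => eps eps0.
  have [a [b [ab bac ay yb]]] := omega_lt y (omega e y + eps) (ltac:(by rewrite ltrDl)).
  rewrite ler_pdivrMl//; apply: le_trans (_ : s * b - s * a <= _).
    by apply: omega_le; rewrite -?scalerA ?ler_pM2l//; apply: bl_leZ2l; rewrite ?ltW.
  by rewrite -mulrBr ler_wpM2l ?ltW.
move=> t0; apply/eqP; rewrite eq_le leZ//=.
rewrite -ler_pdivlMl// -[X in omega e X <= _](scalerK (lt0r_neq0 t0)).
by rewrite leZ// invr_gt0.
Qed.

Lemma omega_unit_shift x t : omega e (x + t *: e) = omega e x.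
Proof.
have le_shift y s : omega e (y + s *: e) <= omega e y.
  apply/ler_addgt0Pr => eps eps0.
  have [a [b [ab bac ay yb]]] := omega_lt y (omega e y + eps) (ltac:(by rewrite ltrDl)).
  apply: le_trans (ltW bac).
  have -> : b - a = (b + s) - (a + s) by ring.
  by apply: omega_le; rewrite ?lerD2r// scalerDl; exact: bl_leD2r.
apply/eqP; rewrite eq_le le_shift/=.
by rewrite -[X in omega e X <= _](addrK (t *: e)) -scaleNr le_shift.
Qed.

(** Shifting by the lower bound [a] moves x from the interval [a e, b e] to [0, (b - a) e]. Norm
    estimates can thus be applied to points known only through their seminorm. *)
Lemma omega_unit_dist x c : omega e x < c -> exists t, `|x + t *: e| <= c.
Proof.
move=> /omega_lt [a [b [ab bac ax xb]]]; exists (- a).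
have c0 : 0 <= c by apply: le_trans (ltW bac); rewrite subr_ge0.
rewrite scaleNr; apply: am_norm_le => //.
  rewrite bl_leBrDr; apply: bl_le_trans ax.
  by rewrite addrC -scalerBl; apply: bl_leZ2r => //; rewrite gerBl.
rewrite bl_leBlDr -scalerDl; apply: bl_le_trans xb _.
by apply: bl_leZ2r => //; lra.
Qed.

End AMUnit.

(** * Nonexpansiveness of order preserving, additively homogeneous maps *)

Section Topical.
Context (R : realType) (X : banachLatticeType R) (e : X) (he : is_am_unit e).
Context (G : X -> X) (GD : additively_homogeneous e G) (Gmono : order_preserving G).
Implicit Types (x y : X) (a b c t : R).

(** The hypothesis reads y + a e <= x, to which [G] is applied. Both nonexpansiveness properties
    follow from this lemma and its dual. *)
Lemma topical_le_sub a x y : bl_le (a *: e) (x - y) -> bl_le (a *: e) (G x - G y).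
Proof. by rewrite !bl_leBrDr addrC => /Gmono; rewrite GD addrC. Qed.

Lemma topical_sub_le b x y : bl_le (x - y) (b *: e) -> bl_le (G x - G y) (b *: e).
Proof. by rewrite !bl_leBlDr [_ + y]addrC => /Gmono; rewrite GD addrC. Qed.

Lemma topical_omega x y : omega e (G x - G y) <= omega e (x - y).
Proof.
apply/ler_addgt0Pr => eps eps0.
have [a [b [ab bac ax xb]]] := omega_lt _ _ _ he (x - y) (omega e (x - y) + eps)
  (ltac:(by rewrite ltrDl)).
apply: le_trans (ltW bac); apply: omega_le => //.
  exact: topical_le_sub.
exact: topical_sub_le.
Qed.

Lemma topical_norm x y : `|G x - G y| <= `|x - y|.
Proof.
apply/ler_addgt0Pr => eps eps0.
have xye : `|x - y| < `|x - y| + eps by rewrite ltrDl.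
have /andP[ax xb] := am_norm_lt _ _ _ he _ _ xye.
apply: (am_norm_le _ _ _ he); first by rewrite (le_trans (normr_ge0 _) (ltW xye)).
  by rewrite -scaleNr; apply: topical_le_sub; rewrite scaleNr.
exact: topical_sub_le.
Qed.

Lemma topical_iter n :
  additively_homogeneous e (iter n G) /\ order_preserving (iter n G).
Proof.
by elim: n => [|n [IHD IHm]]; split=> // [x t|x y xy] /=; [rewrite IHD GD|exact/Gmono/IHm].
Qed.

End Topical.

(** * Orbits of such maps when 0 is fixed *)

Section TopicalFixedZero.
Context (R : realType) (X : banachLatticeType R) (e : X) (he : is_am_unit e).
Context (G : X -> X) (GD : additively_homogeneous e G) (Gmono : order_preserving G).
Context (G0 : G 0 = 0).
Implicit Types (x y : X) (a b c t : R).

Lemma topical_iter0 n : iter n G 0 = 0.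
Proof. by elim: n => //= n ->. Qed.

Lemma topical_iter_omega n x : omega e (iter n G x) <= omega e x.
Proof.
have [GnD Gnm] := topical_iter _ _ _ _ GD Gmono n.
have := topical_omega _ _ _ he _ GnD Gnm x 0.
by rewrite topical_iter0 !subr0.
Qed.

Lemma topical_iter_norm n x : `|iter n G x| <= `|x|.
Proof.
have [GnD Gnm] := topical_iter _ _ _ _ GD Gmono n.
have := topical_norm _ _ _ he _ GnD Gnm x 0.
by rewrite topical_iter0 !subr0.
Qed.

(* The intervals [a e, b e] are invariant, so the best lower bounds of the
   iterates increase, and they stay below all the upper bounds. *)
Lemma topical_iter_center x :
  exists lam, forall n, `|iter n G x - lam *: e| <= omega e (iter n G x).
Proof.
have [ee|en0] := eqVneq e 0.
  by exists 0 => n; rewrite (am_unit0 _ _ _ he (iter n G x - 0 *: e) ee) normr0 omega_ge0.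
have keep_ge k n a : bl_le (a *: e) (iter n G x) -> bl_le (a *: e) (iter (k + n) G x).
  move=> ax; have [GnD Gnm] := topical_iter _ _ _ _ GD Gmono k.
  have := topical_le_sub _ _ _ _ GnD Gnm a (iter n G x) 0.
  by rewrite topical_iter0 !subr0 iterD; apply.
have keep_le k n b : bl_le (iter n G x) (b *: e) -> bl_le (iter (k + n) G x) (b *: e).
  move=> xb; have [GnD Gnm] := topical_iter _ _ _ _ GD Gmono k.
  have := topical_sub_le _ _ _ _ GnD Gnm b (iter n G x) 0.
  by rewrite topical_iter0 !subr0 iterD; apply.
pose S := [set a | exists n, bl_le (a *: e) (iter n G x)].
have Sb n b : bl_le (iter n G x) (b *: e) -> ubound S b.
  (* Bounds found at times k and n are both carried to time n + k, where they can be compared. *)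
  move=> xb a [k ax]; apply: (am_unit_le _ _ _ he _ _ (iter (n + k) G x)) => //.
    exact: keep_ge.
  by rewrite addnC; exact: keep_le.
exists (sup S) => n; apply/ler_addgt0Pr => eps eps0.
have [a [b [ab bac ax xb]]] := omega_lt _ _ _ he (iter n G x)
  (omega e (iter n G x) + eps) (ltac:(by rewrite ltrDl)).
have aS : a <= sup S.
  by apply: ub_le_sup; [exists b; exact: Sb xb|exists n].
have Sbn : sup S <= b by apply: ge_sup; [exists a, n|exact: Sb xb].
have e0 := he.1.
(* Both the iterate and [sup S *: e] lie between a e and b e, so they differ by at most b - a in
   norm. *)
apply: le_trans (ltW bac); apply: (am_norm_le _ _ _ he).
- by rewrite subr_ge0.
- rewrite -scaleNr bl_leBrDr -scalerDl; apply: bl_le_trans ax.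
  by apply: bl_leZ2r => //; lra.
- rewrite bl_leBlDr -scalerDl; apply: bl_le_trans xb _.
  by apply: bl_leZ2r => //; lra.
Qed.

(** * The semidifferential at 0 and its iterates *)

Section SemidifferentialAtZero.
Context (h : X -> X) (hZ : positively_homogeneous h).
Context (Gh : forall eps : R, 0 < eps -> exists2 d, 0 < d &
  forall x, `|x| < d -> `|G x - h x| <= eps * `|x|).

(** By positive homogeneity h x is approximated by G (t x) / t for small t > 0, so bounds on [G]
    that are compatible with scaling pass to [h]. *)
Lemma semidifferential_quotient x c : 0 < c ->
  exists2 t, 0 < t & `|G (t *: x) - t *: h x| <= t * c.
Proof.
move=> c0; have x1 : 0 < `|x| + 1 by rewrite ltr_wpDl.
have [d d0 dP] := Gh (c / (`|x| + 1)) (divr_gt0 c0 x1).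
have t0 : 0 < d / (`|x| + 1) by exact: divr_gt0.
exists (d / (`|x| + 1)) => //; set t := d / _ in t0 *.
rewrite -hZ//; apply: le_trans (dP _ _) _; rewrite normrZ gtr0_norm//.
  by rewrite /t mulrAC ltr_pdivrMr// ltr_pM2l// ltrDl.
by rewrite mulrCA ler_pM2l// mulrAC ler_pdivrMr// ler_pM2l// lerDl.
Qed.

Lemma semidifferential_norm x : `|h x| <= `|x|.
Proof.
apply/ler_addgt0Pr => c c0.
have [t t0 tP] := semidifferential_quotient x _ c0.
rewrite -(ler_pM2l t0) -[X in X * `|h x|](gtr0_norm t0) -normrZ.
have := topical_iter_norm 1 (t *: x); rewrite /= normrZ gtr0_norm// => Gt.
have := ler_distD (G (t *: x)) (t *: h x) 0; rewrite !subr0 distrC.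
by move=> /le_trans; apply; rewrite mulrDr addrC lerD.
Qed.

Lemma semidifferential_omega x : omega e (h x) <= omega e x.
Proof.
apply/ler_addgt0Pr => c c0.
(* The seminorm is at most twice the norm, hence the tolerance [c / 2]. *)
have [t t0 tP] := semidifferential_quotient x (c / 2) (ltac:(by rewrite divr_gt0)).
rewrite -(ler_pM2l t0).
have := topical_iter_omega 1 (t *: x); rewrite /= (omegaZ _ _ _ he)// => Gt.
have := omegaD _ _ _ he (G (t *: x)) (t *: h x - G (t *: x)).
have := omega_le_norm _ _ _ he (t *: h x - G (t *: x)).
rewrite subrKC distrC (omegaZ _ _ _ he _ (h x))// mulrDr => h1 h2.
lra.
Qed.

Lemma semidifferential_iter_norm n x : `|iter n h x| <= `|x|.
Proof. by elim: n => //= n; apply: le_trans (semidifferential_norm _). Qed.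

Lemma semidifferential_iter_omega n x : omega e (iter n h x) <= omega e x.
Proof. by elim: n => //= n; apply: le_trans (semidifferential_omega _). Qed.

(* Chain rule: G is nonexpansive, hence so are the errors it propagates. *)
Lemma semidifferential_iter n (eps : R) : 0 < eps -> exists2 d, 0 < d &
  forall x, `|x| < d -> `|iter n G x - iter n h x| <= eps * `|x|.
Proof.
elim: n eps => [|n IH] eps eps0.
  by exists 1 => // x _; rewrite /= subrr normr0 mulr_ge0// ltW.
have [d1 d10 d1P] := IH (eps / 2) (ltac:(by rewrite divr_gt0)).
have [d2 d20 d2P] := Gh (eps / 2) (ltac:(by rewrite divr_gt0)).
exists (Num.min d1 d2) => [|x]; first by rewrite lt_min d10.
rewrite lt_min => /andP[xd1 xd2] /=.
have hx := semidifferential_iter_norm n x.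
have h1 := topical_norm _ _ _ he _ GD Gmono (iter n G x) (iter n h x).
have h2 := d2P _ (le_lt_trans hx xd2).
have h3 := d1P x xd1.
have h4 : eps / 2 * `|iter n h x| <= eps / 2 * `|x| by rewrite ler_wpM2l// divr_ge0 ?ltW.
(* Through the intermediate point [G (iter n h x)], one error is propagated by [G] and the other is
   that of [h] at [iter n h x], whose norm is at most that of x. *)
have := ler_distD (G (iter n h x)) (G (iter n G x)) (h (iter n h x)).
move=> /le_trans; apply; rewrite [leRHS](_ : _ = eps / 2 * `|x| + eps / 2 * `|x|).
  by rewrite lerD// ?(le_trans h1)// (le_trans h2).
by rewrite -mulrDl -splitr.
Qed.

(** * Operator seminorms and the spectral radius *)

Lemma omega_op_le (g : X -> X) c : 0 <= c ->
  (forall x, omega e (g x) <= c * omega e x) -> (omega_op e g <= c%:E)%E.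
Proof.
move=> c0 gc; rewrite /omega_op ge_max lee_fin c0/=.
apply: ge_ereal_sup => _ [x /= x0 <-]; rewrite lee_fin ler_pdivrMr//.
by rewrite lt_def x0 omega_ge0.
Qed.

Lemma omega_op_ge0 (g : X -> X) : (0 <= omega_op e g)%E.
Proof. by rewrite /omega_op le_max lexx. Qed.

Lemma omega_op_iterE n :
  omega_op e (iter n h) = (fine (omega_op e (iter n h)))%:E.
Proof.
have le1 : (omega_op e (iter n h) <= 1%:E)%E.
  by apply: omega_op_le => // x; rewrite mul1r semidifferential_iter_omega.
rewrite fineK// ge0_fin_numE ?omega_op_ge0//.
by rewrite (le_lt_trans le1)// ltry.
Qed.

Lemma omega_op_iter n x :
  omega e (iter n h x) <= fine (omega_op e (iter n h)) * omega e x.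
Proof.
(* Points of zero seminorm do not enter the supremum; for them nonexpansiveness of [h] suffices. *)
have [x0|x0] := eqVneq (omega e x) 0.
  by rewrite x0 mulr0 -x0 semidifferential_iter_omega.
rewrite -ler_pdivrMr; last by rewrite lt_def x0 omega_ge0.
rewrite -lee_fin -omega_op_iterE /omega_op le_max.
by apply/orP; right; apply: ereal_sup_ubound; exists x.
Qed.

Lemma omega_op_iterD m n : fine (omega_op e (iter (m + n) h)) <=
  fine (omega_op e (iter m h)) * fine (omega_op e (iter n h)).
Proof.
have u0 k : 0 <= fine (omega_op e (iter k h)) by rewrite fine_ge0 ?omega_op_ge0.
rewrite -lee_fin -omega_op_iterE; apply: omega_op_le => [|x]; first exact: mulr_ge0.
rewrite iterD (le_trans (omega_op_iter _ _))// -mulrA ler_wpM2l//.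
exact: omega_op_iter.
Qed.

(** Fekete's lemma applies to the operator seminorms of the iterates, which are finite and
    submultiplicative. Its last clause supplies the contracting iterate. *)
Lemma omega_spectral_radiusP : exists L : R, [/\ 0 <= L,
  omega_spectral_radius e h = L%:E &
  forall s, L < s -> exists2 m, (0 < m)%N &
    exists2 c, c < s ^+ m & forall x, omega e (iter m h x) <= c * omega e x].
Proof.
have u0 k : 0 <= fine (omega_op e (iter k h)) by rewrite fine_ge0 ?omega_op_ge0.
have [L [L0 limL Ls]] := submultiplicative_root_cvg _ u0 omega_op_iterD.
exists L; split=> // [|s /Ls [m m0 um]].
  rewrite -limL /omega_spectral_radius; congr (limn _); apply/funext => k.
  by rewrite omega_op_iterE poweR_EFin.
by exists m => //; exists (fine (omega_op e (iter m h))) => // x; exact: omega_op_iter.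
Qed.

(** * From contraction near 0 to geometric decay of all orbits *)

Lemma topical_iter_local_contraction m c s : c < s ->
  (forall x, omega e (iter m h x) <= c * omega e x) ->
  exists2 d, 0 < d & forall x, omega e x <= d -> omega e (iter m G x) <= s * omega e x.
Proof.
move=> cs hc; have [|d d0 dP] := semidifferential_iter m ((s - c) / 4).
  by rewrite divr_gt0// subr_gt0.
exists (d / 3) => [|x xd]; first by rewrite divr_gt0.
have [x0|x0] := eqVneq (omega e x) 0.
  by rewrite x0 mulr0 -x0 topical_iter_omega.
have xp : 0 < omega e x by rewrite lt_def x0 omega_ge0.
have [|t xt] := omega_unit_dist _ _ _ he x (2 * omega e x); first lra.
have [GmD _] := topical_iter _ _ _ _ GD Gmono m.
set z := x + t *: e in xt.
have zx : omega e z = omega e x by exact: omega_unit_shift.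
have -> : omega e (iter m G x) = omega e (iter m G z).
  by rewrite /z GmD omega_unit_shift.
have zd : `|z| < d by lra.
have h1 := dP _ zd.
have h2 := omega_le_norm _ _ _ he (iter m G z - iter m h z).
have h3 := omegaD _ _ _ he (iter m h z) (iter m G z - iter m h z).
rewrite subrKC in h3.
have h4 := hc z; rewrite zx in h4.
have h5 : (s - c) / 4 * `|z| <= (s - c) / 4 * (2 * omega e x).
  by rewrite ler_wpM2l// divr_ge0// subr_ge0 ltW.
apply: le_trans h3 _; nra.
Qed.

(* Nonexpansiveness along the ray from 0 to x turns contraction near 0 into a
   decrease by at least (1 - s) d outside of the ball of radius d. *)
Lemma topical_enter_ball m s d x : 0 < d -> s < 1 ->
  (forall y, omega e y <= d -> omega e (iter m G y) <= s * omega e y) ->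
  exists N, omega e (iter N G x) <= d.
Proof.
move=> d0 s1 loc; apply: contrapT => /forallNP far.
have {}far n : d < omega e (iter n G x) by rewrite ltNge; exact/negP/far.
have [GmD Gmm] := topical_iter _ _ _ _ GD Gmono m.
have step y : d < omega e y -> omega e (iter m G y) <= omega e y - (1 - s) * d.
  move=> yd; have y0 : 0 < omega e y := lt_trans d0 yd.
  (* The point r y has seminorm exactly d: there [loc] gives s d, and the remaining segment to y
     contributes at most [omega e y - d]. *)
  set r := d / omega e y; have r0 : 0 < r by exact: divr_gt0.
  have r1 : r < 1 by rewrite ltr_pdivrMr// mul1r.
  have ryd : omega e (r *: y) = d by rewrite (omegaZ _ _ _ he)// divfK ?gt_eqF.
  have h1 := omegaD _ _ _ he (iter m G (r *: y)) (iter m G y - iter m G (r *: y)).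
  rewrite subrKC in h1.
  have h2 := topical_omega _ _ _ he _ GmD Gmm y (r *: y).
  have h3 : omega e (y - r *: y) = omega e y - d.
    by rewrite -[X in X - _]scale1r -scalerBl (omegaZ _ _ _ he) ?subr_gt0// mulrBl mul1r divfK ?gt_eqF.
  have := loc (r *: y); rewrite ryd lexx => /(_ isT); lra.
have dec k : omega e (iter (k * m) G x) <= omega e x - k%:R * ((1 - s) * d).
  elim: k => [|k IH]; first by rewrite mul0n mul0r subr0.
  rewrite mulSn iterD -natr1 mulrDl mul1r.
  have := step _ (far (k * m)%N); lra.
have c0 : 0 < (1 - s) * d by rewrite mulr_gt0// subr_gt0.
have := archi_boundP (divr_ge0 (omega_ge0 _ _ _ he x) (ltW c0)).
set k := Num.bound _; rewrite ltr_pdivrMr// => kc.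
have := dec k; have := far (k * m)%N; lra.
Qed.

Lemma topical_iter_geometric L x :
  omega_spectral_radius e h = L%:E -> L < 1 ->
  forall s, L < s -> exists C, forall n, omega e (iter n G x) <= C * s ^+ n.
Proof.
move=> rL L1 s Ls; have [L' [L0 + small]] := omega_spectral_radiusP.
rewrite rL => -[LL']; rewrite -LL' in L0 small.
(* Here s may be 1 or more, whereas entering the ball takes a rate below 1. *)
pose r := Num.min s ((L + 1) / 2).
have Lr : L < r by rewrite lt_min Ls/=; lra.
have r1 : r < 1 by rewrite gt_min; apply/orP; right; lra.
have rs : r <= s by rewrite ge_min lexx.
have r0 : 0 < r := le_lt_trans L0 Lr.
have [m m0 [c cr hc]] := small r Lr.
have [d d0 dP] := topical_iter_local_contraction m c _ cr hc.
have rm1 : r ^+ m < 1 by rewrite exprn_ilt1// ?ltW// -lt0n.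
have [N Nd] := topical_enter_ball m _ d x d0 rm1 dP.
have [k|n Nn|C CP] := @recurrence_geometric_bound R (fun n => omega e (iter n G x)) r m N r0 m0.
- exact: omega_ge0.
(* The seminorm does not increase along orbits, so the orbit never leaves the ball after time
   [N]. *)
- rewrite iterD; apply: dP; apply: le_trans Nd.
  by rewrite -(subnK Nn) iterD topical_iter_omega.
exists C => n; apply: le_trans (CP n) _; rewrite ler_wpM2l//.
  by have := CP 0%N; rewrite expr0 mulr1; apply: le_trans; exact: omega_ge0.
by rewrite lerXn2r// nnegrE ltW// (lt_le_trans r0).
Qed.

End SemidifferentialAtZero.
End TopicalFixedZero.

(** * Translation of the fixed point v to 0 and conclusion *)

Theorem corollary10p6 (R : realType)
    (X : banachLatticeType R) (e : X) (he : is_am_unit e)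
    (F : X -> X) (hFadd : additively_homogeneous e F)
    (hFmono : order_preserving F)
    (v : X) (hv : v \in [set x : X | F x = x])
    (hA1 : semidifferentiable F v)
    (hA2 : (omega_spectral_radius e (semidifferential F v) < 1)%E) :
  forall x : X,
    (limn_esup (fun k : nat =>
        (omega e (iter k F x - v) `^ (k%:R)^-1)%:E)
      <= omega_spectral_radius e (semidifferential F v))%E /\
    exists lam : R,
      (limn_esup (fun k : nat =>
          (`|iter k F x - lam *: e - v| `^ (k%:R)^-1)%:E)
        <= omega_spectral_radius e (semidifferential F v))%E.
Proof.
move=> x; have Fv : F v = v by move: hv; rewrite inE.
(* By (A1) the chosen map is a genuine semidifferential and not the default value of [xget]. *)
have : is_semidifferential F v (semidifferential F v) by exact: xgetPex.
move: (semidifferential F v) hA2 => h r1 [_ hZ /eqaddoP Fh].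
pose G y := F (v + y) - v.
have GD : additively_homogeneous e G by move=> y t; rewrite /G addrA hFadd addrAC.
have Gmono : order_preserving G.
  move=> y z yz; apply: bl_leD2r; apply: hFmono.
  by rewrite ![v + _]addrC; exact: bl_leD2r.
have G0 : G 0 = 0 by rewrite /G addr0 Fv subrr.
have Gh (eps : R) : 0 < eps -> exists2 d, 0 < d &
    forall y, `|y| < d -> `|G y - h y| <= eps * `|y|.
  move=> /Fh /nbhs_norm0P [d /= d0 dP]; exists d => // y yd.
  by have := dP y yd; rewrite /= normr_id !fctE Fv /G opprD addrA.
have GF n : iter n F x - v = iter n G (x - v).
  by elim: n => //= n <-; rewrite /G subrKC.
have [L [L0 rL _]] := omega_spectral_radiusP _ _ _ he _ GD Gmono G0 h hZ Gh.
rewrite rL lte_fin in r1 *.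
have geom := topical_iter_geometric _ _ _ he _ GD Gmono G0 h hZ Gh L (x - v) rL r1.
split.
  apply: limn_esup_root_le => // [n|s Ls]; first exact: omega_ge0.
  by have [C CP] := geom s Ls; exists C => n; rewrite GF.
have [lam lamP] := topical_iter_center _ _ _ he _ GD Gmono G0 (x - v).
(* The norm is bounded by the seminorm of the same iterate, so the same geometric bound serves. *)
exists lam; apply: limn_esup_root_le => // s Ls.
have [C CP] := geom s Ls; exists C => n.
by rewrite addrAC GF (le_trans (lamP n)).
Qed.
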